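(* Let $A$ generate a linear $C_0$-semigroup $S_0(t)$ of contractions on a real Hilbert space $H$, and let $B:H\to H$ be a (possibly nonlinear) Lipschitz operator with $B(0)=0$ such that, for some $\delta,T>0$, $$\int_0^T \langle BS_0(t)y,S_0(t)y\rangle\,dt\ \ge\ \delta\|y\|^2,\qquad \forall y\in H.$$ Then there exists $\lambda_{\max}>0$, independent of the initial state $z_0$, such that for all $\lambda\in(0,\lambda_{\max})$ the constant control $v(t)=-\lambda$ uniformly exponentially stabilizes the system $$\frac{dz(t)}{dt}=Az(t)+v(t)Bz(t),\qquad z(0)=z_0,$$ i.e. there exist $M,\sigma>0$ (independent of $z_0$) such that the mild solution satisfies $$\|z(t)\|\le Me^{-\sigma t}\|z_0\|,\qquad \forall t\ge 0,\ \forall z_0\in H.$$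
   Context: $H$ is a real Hilbert space with inner product $\langle\cdot,\cdot\rangle$ and norm $\|\cdot\|$. For a constant control $v(t)=-\lambda$, a mild solution of $\dot z=Az+vBz$, $z(0)=z_0$, is a continuous function $z:[0,\infty)\to H$ satisfying $z(t)=S_0(t)z_0-\lambda\int_0^t S_0(t-s)Bz(s)\,ds$ for all $t\ge 0$. *)

(* Defs.v *)
From Stdlib Require Import Reals.
From Coquelicot Require Import Coquelicot.
Open Scope R_scope.

Record HilbertSpace := {
  hilbert_carrier :> CompleteNormedModule R_AbsRing;
  inner : hilbert_carrier -> hilbert_carrier -> R;
  inner_sym : forall x y, inner x y = inner y x;
  inner_plus_l : forall x y z, inner (plus x y) z = inner x z + inner y z;
  inner_scal_l : forall (a : R) x y, inner (scal a x) y = a * inner x y;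
  inner_norm : forall x, inner x x = norm x ^ 2
}.

Arguments inner {_} _ _.

(* Only the values [S t] with [0 <= t] are constrained or used.
   [is_linear] includes boundedness. *)
Record is_C0_semigroup {H : HilbertSpace} (S : R -> H -> H) : Prop := {
  semigroup_linear : forall t, 0 <= t -> is_linear (S t);
  semigroup_zero : forall x, S 0 x = x;
  semigroup_plus : forall s t x, 0 <= s -> 0 <= t -> S (s + t) x = S s (S t x);
  semigroup_continuous : forall x, filterlim (fun t => S t x) (at_right 0) (locally x)
}.

Definition is_contractive {H : HilbertSpace} (S : R -> H -> H) : Prop :=
  forall t x, 0 <= t -> norm (S t x) <= norm x.

(* [A] is an unbounded operator with domain [domA]; the domain is exactly the
   set of points at which the right derivative of the orbit at 0 exists. *)
Definition generates {H : HilbertSpace} (domA : H -> Prop)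
    (A : {x : H | domA x} -> H) (S : R -> H -> H) : Prop :=
  let has_orbit_derivative (x y : H) :=
    filterlim (fun h : R => scal (/ h) (minus (S h x) x)) (at_right 0) (locally y) in
  (forall x : H, domA x <-> exists y, has_orbit_derivative x y) /\
  (forall x : {x : H | domA x}, has_orbit_derivative (proj1_sig x) (A x)).

Definition is_lipschitz {H : HilbertSpace} (B : H -> H) : Prop :=
  exists L : R, forall x y, norm (minus (B x) (B y)) <= L * norm (minus x y).

(* Only the values [z t] with [0 <= t] matter. The integral is the H-valued
   Riemann integral, whose integrand is continuous on [0, t]. *)
Definition mild_solution {H : HilbertSpace} (S : R -> H -> H) (B : H -> H)
    (lambda : R) (z0 : H) (z : R -> H) : Prop :=
  continuous_on (fun t => 0 <= t) z /\
  forall t, 0 <= t -> exists I : H,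
    is_RInt (fun s => S (t - s) (B (z s))) 0 t I /\
    z t = minus (S t z0) (scal lambda I).

(* "The" mild solution: it exists, it is unique on [0, +oo), and it decays. *)
Definition uniformly_exponentially_stabilized {H : HilbertSpace}
    (S : R -> H -> H) (B : H -> H) (lambda : R) : Prop :=
  exists M sigma : R, 0 < M /\ 0 < sigma /\
    forall z0 : H, exists z : R -> H,
      mild_solution S B lambda z0 z /\
      (forall w, mild_solution S B lambda z0 w -> forall t, 0 <= t -> w t = z t) /\
      (forall t, 0 <= t -> norm (z t) <= M * exp (- sigma * t) * norm z0).

(* Main.v *)
Require Import Defs.
From Stdlib Require Import Reals Lra Lia ssreflect.
From Coquelicot Require Import Coquelicot.
Open Scope R_scope.

(** Over one observation window, compare [z(T)] with [S(T) z0] by expanding the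
    norm of [z(T) = S(T) z0 - lambda I], where [I] is the Duhamel integral.
    Up to [O(lambda^2)], the cross term is the integral of
    [<C B y, C y>] with [y = S(s) z0] and [C = S(T - s)]. Since [C] is a
    contraction, [<b, y> - <C b, C y>] is a positive form, so the Cauchy-Schwarz
    inequality bounds its value at [(B y, y)] by the square root of
    [|y|^2 - |C y|^2 <= |z0|^2 - |S(T) z0|^2]; completing the square, this
    defect is absorbed by the drop of [|S(T) z0|^2] at the cost of another
    [O(lambda^2)]. The observability inequality then gives
    [|z(T)|^2 <= (1 - 2 lambda delta + O(lambda^2)) |z0|^2], which is iterated
    along the multiples of [T]. No energy identity for mild solutions is used.
    Existence and uniqueness come from Picard iteration in the norm weighted by
    [exp (- t / T)]. *)

(** * Algebra of the inner product and the Cauchy-Schwarz inequality *)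

Lemma inner_zero_l {H : HilbertSpace} (x : H) : inner zero x = 0.
Proof.
  pose proof (inner_plus_l H zero zero x) as E. rewrite plus_zero_l in E. lra.
Qed.

Lemma inner_opp_l {H : HilbertSpace} (x y : H) : inner (opp x) y = - inner x y.
Proof.
  pose proof (inner_plus_l H x (opp x) y) as E.
  rewrite plus_opp_r inner_zero_l in E. lra.
Qed.

Lemma inner_minus_l {H : HilbertSpace} (x y z : H) :
  inner (minus x y) z = inner x z - inner y z.
Proof. unfold minus. rewrite inner_plus_l inner_opp_l. ring. Qed.

(** Testing with w = x - y gives |x - y|^2 = 0. *)
Lemma inner_ext {H : HilbertSpace} (x y : H) :
  (forall w, inner x w = inner y w) -> x = y.
Proof.
  intros E. apply Classical_Prop.NNPP; intros ne.
  assert (pos : 0 < norm (minus x y)) by now apply (norm_minus_gt_0 (V := H)).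
  pose proof (inner_norm H (minus x y)) as N.
  rewrite inner_minus_l E in N. nra.
Qed.

(* Identities of vectors are reduced to identities of real numbers by pairing
   both sides with an arbitrary vector. *)
Ltac vector_identity :=
  apply inner_ext; intro;
  repeat rewrite ?inner_minus_l ?inner_plus_l ?inner_opp_l ?inner_scal_l ?inner_zero_l; ring.

(** Expanding the squared norm of |y|^2 x - <x,y> y gives |y|^2 (|x|^2 |y|^2 - <x,y>^2) >= 0.
    Scaling by |y|^2 avoids a division; the case |y| = 0 is separate. *)
Lemma cauchy_schwarz {H : HilbertSpace} (x y : H) :
  Rabs (inner x y) <= norm x * norm y.
Proof.
  pose proof (norm_ge_0 x) as nx. pose proof (norm_ge_0 y) as ny.
  assert (Q : inner x y ^ 2 <= (norm x * norm y) ^ 2).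
  { destruct (Req_dec (norm y) 0) as [y0 | y0].
    - rewrite (norm_eq_zero y y0) inner_sym inner_zero_l norm_zero. lra.
    - pose proof (pow2_ge_0
        (norm (minus (scal (norm y ^ 2) x) (scal (inner x y) y)))) as P.
      rewrite -inner_norm in P.
      rewrite inner_minus_l !inner_scal_l (inner_sym H x) (inner_sym H y)
        !inner_minus_l !inner_scal_l !inner_norm (inner_sym H y x) in P.
      assert (y2 : 0 < norm y ^ 2) by (apply pow_lt; lra).
      nra. }
  rewrite <- (Rabs_pos_eq (norm x * norm y)) by nra.
  apply Rsqr_le_abs_0. unfold Rsqr. nra.
Qed.

(** This lets the pairing with a fixed vector pass under the integral. [is_linear] asks for a
    strictly positive bound, hence the constant |y| + 1. *)
Lemma inner_is_linear {H : HilbertSpace} (y : H) :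
  is_linear (fun x : H => inner x y : R_NormedModule).
Proof.
  split.
  - intros u v. apply inner_plus_l.
  - intros a u. apply inner_scal_l.
  - exists (norm y + 1). pose proof (norm_ge_0 y). split; [lra |].
    intros x. pose proof (norm_ge_0 x). pose proof (cauchy_schwarz x y).
    change (norm (inner x y : R_NormedModule)) with (Rabs (inner x y)). nra.
Qed.

(** * Norm estimates, continuity and Riemann integrals in normed modules *)

Lemma norm_minus_sym {V : CompleteNormedModule R_AbsRing} (x y : V) :
  norm (minus x y) = norm (minus y x).
Proof. rewrite -norm_opp opp_minus. reflexivity. Qed.

Lemma norm_plus_le {V : CompleteNormedModule R_AbsRing} (x y : V) :
  norm (plus x y) <= norm x + norm y.
Proof. apply (norm_triangle (V := V)). Qed.

Lemma norm_minus_triangle {V : CompleteNormedModule R_AbsRing} (y x z : V) :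
  norm (minus x z) <= norm (minus x y) + norm (minus y z).
Proof. rewrite (minus_trans y). apply norm_plus_le. Qed.

Lemma norm_minus_zero_r {V : CompleteNormedModule R_AbsRing} (x : V) :
  norm (minus x zero) = norm x.
Proof. rewrite minus_zero_r. reflexivity. Qed.

Lemma norm_scal_nonneg {V : CompleteNormedModule R_AbsRing} (a : R) (x : V) :
  0 <= a -> norm (scal a x) <= a * norm x.
Proof.
  intros a0. rewrite <- (Rabs_pos_eq a a0) at 2. apply (norm_scal (V := V) a x).
Qed.

Lemma continuous_norm_eps {V : CompleteNormedModule R_AbsRing} (f : R -> V) (t : R) :
  continuous f t <->
  forall eps : posreal, exists d : posreal, forall u : R,
    Rabs (u - t) < d -> norm (minus (f u) (f t)) < eps.
Proof.
  unfold continuous. rewrite (filterlim_locally_ball_norm (U := V)). reflexivity.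
Qed.

Lemma Riemann_sum_linear {U V : NormedModule R_AbsRing} (l : U -> V) (f : R -> U)
    (ptd : SF_seq) :
  is_linear l -> l (Riemann_sum f ptd) = Riemann_sum (fun x => l (f x)) ptd.
Proof.
  intros ll. induction ptd as [h | h ptd IH] using SF_cons_ind.
  - apply (linear_zero l ll).
  - rewrite !Riemann_sum_cons (linear_plus l ll) (linear_scal l ll).
    f_equal. exact IH.
Qed.

(** A linear map commutes with every Riemann sum and, being bounded, is continuous, so it passes to
    the limit. *)
Lemma is_RInt_linear {U V : NormedModule R_AbsRing} (l : U -> V) (f : R -> U)
    (a b : R) (I : U) :
  is_linear l -> is_RInt f a b I -> is_RInt (fun x => l (f x)) a b (l I).
Proof.
  intros ll HI. unfold is_RInt.
  apply filterlim_ext with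
    (fun ptd => l (scal (sign (b - a) : R_AbsRing) (Riemann_sum f ptd))).
  - intros ptd. rewrite (linear_scal l ll) (Riemann_sum_linear l f ptd ll).
    reflexivity.
  - eapply filterlim_comp; [exact HI |]. apply (linear_cont l I ll).
Qed.

Lemma continuous_bounded_above (f : R -> R) (a b : R) :
  a <= b -> (forall t, continuous f t) ->
  exists t, a <= t <= b /\ forall s, a <= s <= b -> f s <= f t.
Proof.
  intros ab fc. destruct (continuity_ab_maj f a b ab) as [t [Ht It]].
  - intros c _. apply continuity_pt_filterlim, fc.
  - exists t. split; assumption.
Qed.

Lemma continuous_norm {V : CompleteNormedModule R_AbsRing} (f : R -> V) (t : R) :
  continuous f t -> continuous (fun s => norm (f s)) t.
Proof. intros fc. eapply continuous_comp; [exact fc |]. apply filterlim_norm. Qed.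

Lemma ex_RInt_cont {V : CompleteNormedModule R_AbsRing} (f : R -> V) (a b : R) :
  (forall t, continuous f t) -> ex_RInt f a b.
Proof. intros fc. apply ex_RInt_continuous. intros z _. apply fc. Qed.

(** Precomposing with [Rmax 0] extends a function from the half line to all of R. This clamp
    preserves continuity, so continuity can be asked for at every real point. *)
Lemma Rmax_nonexpansive (c u t : R) : Rabs (Rmax c u - Rmax c t) <= Rabs (u - t).
Proof.
  unfold Rmax, Rabs; repeat destruct Rle_dec; repeat destruct Rcase_abs; lra.
Qed.

Lemma continuous_Rmax_l (c t : R) : continuous (Rmax c) t.
Proof.
  apply (continuous_norm_eps (V := R_CompleteNormedModule)).
  intros eps. exists eps. intros u Hu.
  eapply Rle_lt_trans; [apply Rmax_nonexpansive | exact Hu].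
Qed.

(** * The Duhamel integral of a contraction semigroup *)

Section Duhamel.

Context {H : HilbertSpace} (S : R -> H -> H).
Hypothesis hS : is_C0_semigroup S.
Hypothesis hc : is_contractive S.

Lemma semigroup_minus (t : R) (x y : H) :
  0 <= t -> S t (minus x y) = minus (S t x) (S t y).
Proof. intros t0. apply (linear_minus (U := H) (V := H)), (semigroup_linear S hS t t0). Qed.

Lemma semigroup_nonexpansive (t : R) (x y : H) :
  0 <= t -> norm (minus (S t x) (S t y)) <= norm (minus x y).
Proof. intros t0. rewrite <- semigroup_minus by assumption. now apply hc. Qed.

(** S(b) x - S(a) x = S(a) (S(b - a) x - x), and S(a) is a contraction: increments are controlled by
    the behaviour at 0. *)
Lemma orbit_increment (a b : R) (x : H) :
  0 <= a <= b -> norm (minus (S b x) (S a x)) <= norm (minus (S (b - a) x) x).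
Proof.
  intros ab. replace b with (a + (b - a)) at 1 by ring.
  rewrite -> (semigroup_plus S hS) by lra. apply semigroup_nonexpansive. lra.
Qed.

(** Right continuity at 0 becomes two-sided continuity everywhere, because the smaller of the two
    times can always be factored out. *)
Lemma orbit_continuous (x : H) (t : R) : continuous (fun s => S (Rmax 0 s) x) t.
Proof.
  apply (continuous_norm_eps (V := H)). intros eps.
  pose proof (semigroup_continuous S hS x) as C.
  rewrite (filterlim_locally_ball_norm (U := H)) in C. destruct (C eps) as [d Hd].
  exists d. intros u Hu.
  assert (small : forall a b, 0 <= a <= b -> b - a < d ->
            norm (minus (S b x) (S a x)) < eps).
  { intros a b ab bd. destruct (Req_dec a b) as [-> | ne].
    - rewrite minus_eq_zero norm_zero. apply cond_pos.
    - eapply Rle_lt_trans; [now apply orbit_increment |].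
      apply Hd; [| lra]. change (Rabs (b - a - 0) < d). rewrite Rabs_pos_eq; lra. }
  assert (D : Rabs (Rmax 0 u - Rmax 0 t) <= Rabs (u - t)).
  { apply Rmax_nonexpansive. }
  pose proof (Rmax_l 0 u). pose proof (Rmax_l 0 t).
  destruct (Rle_dec (Rmax 0 t) (Rmax 0 u)).
  - apply small; [lra |]. rewrite Rabs_pos_eq in D; lra.
  - rewrite norm_minus_sym. apply small; [lra |]. rewrite Rabs_minus_sym Rabs_pos_eq in D; lra.
Qed.

(** The semigroup is only strongly continuous, so vector and time are varied one after the other,
    through the intermediate point [S (Rmax 0 (g u)) (f t)]. *)
Lemma semigroup_apply_continuous (g : R -> R) (f : R -> H) (t : R) :
  continuous g t -> continuous f t -> continuous (fun s => S (Rmax 0 (g s)) (f s)) t.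
Proof.
  intros gc fc.
  pose proof (continuous_comp g (fun u => S (Rmax 0 u) (f t)) t gc
    (orbit_continuous (f t) (g t))) as oc.
  pose proof (proj1 (continuous_norm_eps (V := H) _ _) fc) as fe.
  pose proof (proj1 (continuous_norm_eps (V := H) _ _) oc) as oe.
  apply (continuous_norm_eps (V := H)). intros eps.
  destruct (fe (pos_div_2 eps)) as [d1 H1]. destruct (oe (pos_div_2 eps)) as [d2 H2].
  assert (dm : 0 < Rmin d1 d2) by (apply Rmin_glb_lt; apply cond_pos).
  exists (mkposreal _ dm). intros u Hu. simpl in Hu.
  pose proof (Rmin_l d1 d2). pose proof (Rmin_r d1 d2).
  specialize (H1 u ltac:(lra)). specialize (H2 u ltac:(lra)). simpl in H1, H2.
  pose proof (norm_minus_triangle (S (Rmax 0 (g u)) (f t)) (S (Rmax 0 (g u)) (f u))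
    (S (Rmax 0 (g t)) (f t))).
  pose proof (semigroup_nonexpansive (Rmax 0 (g u)) (f u) (f t) (Rmax_l _ _)).
  lra.
Qed.

(** Clamping t - s at 0 changes nothing for 0 <= s <= t and makes the integrand continuous on the
    whole line whenever f is. *)
Definition duhamel (f : R -> H) (t : R) : H :=
  RInt (fun s => S (Rmax 0 (t - s)) (f s)) 0 t.

Lemma duhamel_integrand_continuous (f : R -> H) (t s : R) :
  continuous f s -> continuous (fun s => S (Rmax 0 (t - s)) (f s)) s.
Proof.
  intros fc. apply semigroup_apply_continuous; [| exact fc].
  apply (continuous_minus (fun _ => t) (fun s => s));
    [apply continuous_const | apply continuous_id].
Qed.

Lemma is_RInt_duhamel (f : R -> H) (t : R) :
  (forall s, continuous f s) ->
  is_RInt (fun s => S (Rmax 0 (t - s)) (f s)) 0 t (duhamel f t).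
Proof.
  intros fc. apply (RInt_correct (V := H)), ex_RInt_cont.
  intros s. apply duhamel_integrand_continuous, fc.
Qed.

Lemma duhamel_ext (f g : R -> H) (t : R) :
  0 <= t -> (forall s, 0 <= s <= t -> f s = g s) -> duhamel f t = duhamel g t.
Proof.
  intros t0 E. apply RInt_ext. intros s Hs.
  rewrite -> Rmin_left, Rmax_right in Hs by lra. rewrite -> E by lra. reflexivity.
Qed.

Lemma duhamel_minus_le (f g : R -> H) (h : R -> R) (t I : R) :
  0 <= t -> (forall s, continuous f s) -> (forall s, continuous g s) ->
  (forall s, 0 <= s <= t -> norm (minus (f s) (g s)) <= h s) ->
  is_RInt h 0 t I ->
  norm (minus (duhamel f t) (duhamel g t)) <= I.
Proof.
  intros t0 fc gc fg hI.
  eapply norm_RInt_le; [exact t0 | | | exact hI].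
  2: apply (is_RInt_minus (V := H)); apply is_RInt_duhamel; assumption.
  intros s Hs. simpl. eapply Rle_trans; [| now apply fg].
  apply semigroup_nonexpansive, Rmax_l.
Qed.

(** The substitution s -> t - s moves the dependence on t from the semigroup, which is only strongly
    continuous, to f, which is uniformly continuous on compact intervals. *)
Lemma duhamel_reverse (f : R -> H) (t : R) :
  (forall s, continuous f s) ->
  is_RInt (fun s => S (Rmax 0 s) (f (t - s))) 0 t (duhamel f t).
Proof.
  intros fc.
  assert (E : is_RInt (fun s => S (Rmax 0 (t - s)) (f s)) (-1 * 0 + t) (-1 * t + t)
            (opp (duhamel f t))).
  { replace (-1 * 0 + t) with t by ring. replace (-1 * t + t) with 0 by ring.
    apply (is_RInt_swap (V := H)), is_RInt_duhamel, fc. }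
  apply (is_RInt_comp_lin (V := H)) in E.
  apply (is_RInt_opp (V := H)) in E. rewrite opp_opp in E.
  eapply is_RInt_ext; [| exact E]. intros s _. simpl.
  (* The slope -1 of the substitution and the swap of the end points each contribute a sign; the two
     cancel. *)
  rewrite -(scal_opp_one (V := H)) scal_assoc. unfold opp, one, mult; simpl.
  replace (- (1) * -1) with 1 by ring. rewrite (scal_one (V := H)).
  f_equal; f_equal; ring.
Qed.

(** After reversal both integrals carry the same kernel S(s), so on [0, a] only the values of f
    differ; what remains is an integral over [a, b] of norm at most (b - a) M. *)
Lemma duhamel_increment_le (f : R -> H) (a b eps M : R) :
  0 <= a <= b -> (forall s, continuous f s) ->
  (forall s, 0 <= s <= a -> norm (minus (f (b - s)) (f (a - s))) <= eps) ->
  (forall s, 0 <= s <= b -> norm (f s) <= M) ->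
  norm (minus (duhamel f b) (duhamel f a)) <= a * eps + (b - a) * M.
Proof.
  intros ab fc He HM.
  assert (gc : forall t s, continuous (fun s => S (Rmax 0 s) (f (t - s))) s).
  { intros t s. apply (semigroup_apply_continuous (fun s => s));
      [apply continuous_id |].
    apply (continuous_comp (fun s => t - s) f); [| apply fc].
    apply (continuous_minus (fun _ => t) (fun s => s));
      [apply continuous_const | apply continuous_id]. }
  pose proof (duhamel_reverse f a fc) as Ia.
  pose proof (is_RInt_unique _ _ _ _ (duhamel_reverse f b fc)) as Ib.
  rewrite <- (RInt_Chasles (V := H) _ 0 a b) in Ib
    by (apply ex_RInt_cont; intros; apply gc).
  rewrite -Ib.
  pose proof (RInt_correct (V := H) _ 0 a (ex_RInt_cont _ 0 a (gc b))) as I1.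
  pose proof (RInt_correct (V := H) _ a b (ex_RInt_cont _ a b (gc b))) as I2.
  set (X := RInt _ 0 a) in *. set (Y := RInt _ a b) in *.
  replace (minus (plus X Y) (duhamel f a)) with (plus (minus X (duhamel f a)) Y)
    by vector_identity.
  eapply Rle_trans; [apply norm_plus_le |]. apply Rplus_le_compat.
  - replace (a * eps) with ((a - 0) * eps) by ring.
    eapply norm_RInt_le_const;
      [lra | | exact (is_RInt_minus (V := H) _ _ _ _ _ _ I1 Ia)].
    intros s Hs. simpl. eapply Rle_trans; [| now apply (He s)].
    apply semigroup_nonexpansive, Rmax_l.
  - eapply norm_RInt_le_const; [lra | | exact I2].
    intros s Hs. simpl. eapply Rle_trans; [| apply (HM (b - s)); lra].
    apply hc, Rmax_l.
Qed.

Lemma duhamel_continuous (f : R -> H) (t : R) :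
  (forall s, continuous f s) -> continuous (fun s => duhamel f (Rmax 0 s)) t.
Proof.
  intros fc. apply (continuous_norm_eps (V := H)). intros eps.
  (* The margin 1 keeps the clamped value of every u within distance 1 of t inside [0, c]. *)
  set (c := Rmax 0 t + 1). pose proof (Rmax_l 0 t) as t0.
  destruct (continuous_bounded_above (fun s => norm (f s)) 0 c) as [m [_ Hm]].
  { unfold c; lra. }
  { intros s. apply continuous_norm, fc. }
  set (M := norm (f m)) in *. pose proof (norm_ge_0 (f m)) as M0. fold M in M0.
  assert (e0 : 0 < eps / (2 * c)).
  { apply Rdiv_lt_0_compat; [apply cond_pos | unfold c; lra]. }
  destruct (unifcont_normed_1d f 0 c (fun s _ => fc s) (mkposreal _ e0))
    as [d Hd].
  pose proof (cond_pos eps) as ep. pose proof (cond_pos d) as dp.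
  (* The three radii serve the uniform continuity of f, staying below c, and a short end piece.
     Using M + 1 keeps the quotient meaningful when M = 0. *)
  assert (r0 : 0 < Rmin (Rmin d 1) (eps / (2 * (M + 1)))).
  { repeat apply Rmin_glb_lt; [exact dp | lra |]. apply Rdiv_lt_0_compat; lra. }
  exists (mkposreal _ r0). intros u Hu. simpl in Hu.
  apply Rmin_Rgt_l in Hu as [Hu Hu3]. apply Rmin_Rgt_l in Hu as [Hu1 Hu2].
  pose proof (Rmax_nonexpansive 0 u t) as D. pose proof (Rmax_l 0 u) as u0.
  assert (small : forall a b, 0 <= a <= b -> b <= c -> b - a <= Rabs (u - t) ->
            norm (minus (duhamel f b) (duhamel f a)) < eps).
  { intros a b ab bc bd.
    eapply Rle_lt_trans.
    - apply (duhamel_increment_le f a b (eps / (2 * c)) M ab fc).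
      + intros s Hs. apply Rlt_le.
        apply (Hd (a - s) (b - s)); [lra | lra |].
        change (Rabs (b - s - (a - s)) < d). rewrite Rabs_pos_eq; lra.
      + intros s Hs. apply Hm. lra.
    - assert (E1 : a * (eps / (2 * c)) <= eps / 2).
      { replace (eps / 2) with (c * (eps / (2 * c))) by (field; unfold c; lra).
        apply Rmult_le_compat_r; lra. }
      assert (E2 : (b - a) * M < eps / 2).
      { apply Rle_lt_trans with (eps / (2 * (M + 1)) * M).
        - apply Rmult_le_compat_r; lra.
        - assert (0 < eps / (2 * (M + 1))) by (apply Rdiv_lt_0_compat; lra).
          replace (eps / 2) with (eps / (2 * (M + 1)) * (M + 1)) by (field; lra).
          nra. }
      lra. }
  destruct (Rle_dec (Rmax 0 t) (Rmax 0 u)).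
  - rewrite Rabs_pos_eq in D; [| lra]. apply small; unfold c; lra.
  - rewrite norm_minus_sym. rewrite Rabs_minus_sym Rabs_pos_eq in D; [| lra].

    apply small; unfold c; lra.
Qed.

(** The integral is split at s. On [0, s] the semigroup law takes out the bounded linear map S(t);
    on [s, s + t] the variable is translated by s. *)
Lemma duhamel_shift (f : R -> H) (s t : R) :
  0 <= s -> 0 <= t -> (forall r, continuous f r) ->
  duhamel f (s + t) = plus (S t (duhamel f s)) (duhamel (fun r => f (s + r)) t).
Proof.
  intros s0 t0 fc.
  assert (gc : forall r, continuous (fun r => S (Rmax 0 (s + t - r)) (f r)) r).
  { intros r. apply duhamel_integrand_continuous, fc. }
  unfold duhamel at 1.
  rewrite <- (RInt_Chasles (V := H) _ 0 s (s + t)) by now apply ex_RInt_cont.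
  f_equal.
  - apply is_RInt_unique.
    eapply is_RInt_ext;
      [| exact (is_RInt_linear (U := H) (V := H) (S t) _ _ _ _
           (semigroup_linear S hS t t0) (is_RInt_duhamel f s fc))].
    intros r. rewrite -> Rmin_left, Rmax_right by lra. intros Hr.
    rewrite <- (semigroup_plus S hS) by (exact t0 || apply Rmax_l).
    rewrite -> !Rmax_right by lra. f_equal; ring.
  - assert (E : is_RInt (fun r => S (Rmax 0 (s + t - r)) (f r)) (1 * 0 + s) (1 * t + s)
              (RInt (fun r => S (Rmax 0 (s + t - r)) (f r)) s (s + t))).
    { replace (1 * 0 + s) with s by ring. replace (1 * t + s) with (s + t) by ring.
      apply (RInt_correct (V := H)). now apply ex_RInt_cont. }
    apply (is_RInt_comp_lin (V := H)) in E.
    symmetry. apply is_RInt_unique. eapply is_RInt_ext; [| exact E].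
    intros r _. cbv beta. rewrite (scal_one (V := H)).
    replace (1 * r + s) with (s + r) by ring.
    replace (s + t - (s + r)) with (t - r) by ring. reflexivity.
Qed.

End Duhamel.

(** * Uniform limits, geometric convergence and integrals of exponentials *)

(** Three errors of eps/4 along f u, g u, g t, f t stay strictly below eps, although the
    approximation bound is not strict. *)
Lemma continuous_of_approximations {V : CompleteNormedModule R_AbsRing} (f : R -> V) (t : R) :
  (forall eps : posreal, exists g : R -> V, continuous g t /\
     locally t (fun u => norm (minus (f u) (g u)) <= eps)) ->
  continuous f t.
Proof.
  intros A. apply (continuous_norm_eps (V := V)). intros eps.
  pose proof (cond_pos eps) as ep. assert (e4 : 0 < eps / 4) by lra.
  destruct (A (mkposreal _ e4)) as [g [gc [d1 H1]]]. simpl in H1.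
  destruct (proj1 (continuous_norm_eps (V := V) _ _) gc (mkposreal _ e4)) as [d2 H2].
  simpl in H2.
  assert (dm : 0 < Rmin d1 d2) by (apply Rmin_glb_lt; apply cond_pos).
  exists (mkposreal _ dm). intros u Hu. simpl in Hu.
  apply Rmin_Rgt_l in Hu as [Hu1 Hu2].
  specialize (H2 u Hu2). pose proof (H1 t (ball_center t d1)) as H1t.
  specialize (H1 u Hu1).
  pose proof (norm_minus_triangle (g u) (f u) (f t)).
  pose proof (norm_minus_triangle (g t) (g u) (f t)).
  rewrite (norm_minus_sym (f t)) in H1t. lra.
Qed.

Lemma eq_of_norm_minus_le_zero {V : CompleteNormedModule R_AbsRing} (x y : V) :
  norm (minus x y) <= 0 -> x = y.
Proof.
  intros N. apply Classical_Prop.NNPP; intros ne.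
  assert (0 < norm (minus x y)) by now apply (norm_minus_gt_0 (V := V)). lra.
Qed.

Lemma exp_le_compat (a b : R) : a <= b -> exp a <= exp b.
Proof.
  intros [ab | ->]; [apply Rlt_le, exp_increasing, ab | apply Rle_refl].
Qed.

Lemma half_pow_small (C eps : R) : 0 < eps -> exists n, C * (/ 2) ^ n < eps.
Proof.
  intros e0. pose proof (Rabs_pos C) as C0. pose proof (Rle_abs C) as CC.
  destruct (pow_lt_1_zero (/ 2)) with (y := eps / (Rabs C + 1)) as [n Hn].
  - rewrite Rabs_pos_eq; lra.
  - apply Rdiv_lt_0_compat; lra.
  - exists n. specialize (Hn n (le_n n)). pose proof (pow_lt (/ 2) n ltac:(lra)) as p0.
    rewrite Rabs_pos_eq in Hn; [| lra].
    replace eps with (eps / (Rabs C + 1) * (Rabs C + 1)) by (field; lra).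
    nra.
Qed.

Lemma le_zero_of_half_pow (x C : R) : (forall n, x <= C * (/ 2) ^ n) -> x <= 0.
Proof.
  intros Hx. destruct (Rle_dec x 0) as [| n0]; [assumption |].
  destruct (half_pow_small C x) as [n Hn]; [lra |]. specialize (Hx n). lra.
Qed.

(** The result is a [sig] rather than an existential, so that the limits at all times can be
    assembled into a function without choice. *)
Lemma geometric_cauchy_limit {V : CompleteNormedModule R_AbsRing} (x : nat -> V) (C : R) :
  (forall n j, norm (minus (x (n + j)%nat) (x n)) <= C * (/ 2) ^ n) ->
  {l : V | forall n, norm (minus l (x n)) <= C * (/ 2) ^ n}.
Proof.
  intros Hx. exists (lim (filtermap x eventually)). intros n.
  assert (L : filterlim x eventually (locally (lim (filtermap x eventually)))).
  { apply filterlim_locally. intros eps.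
    apply (complete_cauchy (filtermap x eventually)).
    - apply filtermap_proper_filter, eventually_filter.
    - intros e. destruct (half_pow_small C e (cond_pos e)) as [N HN].
      exists (x N). exists N. intros m Hm. apply (norm_compat1 (V := V)).
      replace m with (N + (m - N))%nat by lia. specialize (Hx N (m - N)%nat).
      eapply Rle_lt_trans; [exact Hx | exact HN]. }
  rewrite (filterlim_locally_ball_norm (U := V)) in L.
  (* The bound passes to the limit by comparison with a far term [x (n + N)], at a cost e that is
     arbitrary. *)
  apply le_epsilon. intros e e0.
  destruct (L (mkposreal e e0)) as [N HN]. specialize (HN (n + N)%nat ltac:(lia)).
  unfold ball_norm in HN; simpl in HN.
  pose proof (norm_minus_triangle (x (n + N)%nat)
    (lim (filtermap x eventually) : V) (x n)) as T.
  rewrite (norm_minus_sym _ (x (n + N)%nat)) in T. specialize (Hx n N).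
  eapply Rle_trans; [exact T |]. rewrite Rplus_comm.
  apply Rplus_le_compat; [exact Hx | apply Rlt_le, HN].
Qed.

Lemma is_RInt_exp (k c t : R) :
  k <> 0 -> is_RInt (fun s => c * exp (k * s)) 0 t (c * (exp (k * t) - 1) / k).
Proof.
  intros k0.
  replace (c * (exp (k * t) - 1) / k)
    with (minus (c * exp (k * t) / k) (c * exp (k * 0) / k)).
  - apply (is_RInt_derive (V := R_CompleteNormedModule)
      (fun s => c * exp (k * s) / k)).
    + intros s _. auto_derive; [exact I |]. field. exact k0.
    + intros s _. apply (ex_derive_continuous (V := R_NormedModule)). auto_derive. exact I.
  - rewrite Rmult_0_r exp_0. unfold minus, plus, opp; simpl. field. exact k0.
Qed.

(** * Mild solutions *)

Section MildSolutions.

Context {H : HilbertSpace} (S : R -> H -> H).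
Hypothesis hS : is_C0_semigroup S.
Hypothesis hc : is_contractive S.
Context (B : H -> H) (L lambda k : R).
Hypothesis hL : 0 <= L.
Hypothesis hB : forall x y, norm (minus (B x) (B y)) <= L * norm (minus x y).
Hypothesis hB0 : B zero = zero.
Hypothesis hl : 0 <= lambda.
Hypothesis hk : 0 < k.
Hypothesis hlk : 2 * lambda * L <= k.

Lemma lipschitz_continuous (f : R -> H) (t : R) :
  continuous f t -> continuous (fun s => B (f s)) t.
Proof.
  intros fc. apply (continuous_norm_eps (V := H)). intros eps.
  assert (e0 : 0 < eps / (L + 1)).
  { apply Rdiv_lt_0_compat; [apply cond_pos | lra]. }
  destruct (proj1 (continuous_norm_eps (V := H) _ _) fc (mkposreal _ e0)) as [d Hd].
  exists d. intros u Hu. specialize (Hd u Hu). simpl in Hd.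
  specialize (hB (f u) (f t)).
  replace (pos eps) with (eps / (L + 1) * (L + 1)) by (field; lra).
  pose proof (norm_ge_0 (minus (f u) (f t))). nra.
Qed.

Lemma continuous_clamp (f : R -> H) (t : R) :
  (forall s, continuous f s) -> continuous (fun s => f (Rmax 0 s)) t.
Proof.
  intros fc. apply (continuous_comp (Rmax 0) f); [apply continuous_Rmax_l | apply fc].
Qed.

(** The two integrands agree on (0, t). The notion is thereby restated with functions continuous on
    all of R and with the total function [duhamel]. *)
Lemma mild_solution_iff (z0 : H) (z : R -> H) :
  mild_solution S B lambda z0 z <->
  (forall t, continuous (fun s => z (Rmax 0 s)) t) /\
  forall t, 0 <= t ->
    z t = minus (S t z0) (scal lambda (duhamel S (fun s => B (z (Rmax 0 s))) t)).
Proof.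
  assert (E : forall t s, 0 <= t -> Rmin 0 t < s < Rmax 0 t ->
            S (Rmax 0 (t - s)) (B (z (Rmax 0 s))) = S (t - s) (B (z s))).
  { intros t s t0. rewrite -> Rmin_left, (Rmax_right 0 t) by lra. intros Hs.
    rewrite -> !Rmax_right by lra. reflexivity. }
  split.
  - intros [zc ze].
    assert (zR : forall t, continuous (fun s => z (Rmax 0 s)) t).
    { intros t P HP. destruct (zc (Rmax 0 t) (Rmax_l 0 t) P HP) as [d Hd].
      exists d. intros u Hu. apply Hd; [| apply Rmax_l].
      eapply Rle_lt_trans; [apply Rmax_nonexpansive | exact Hu]. }
    split; [exact zR |]. intros t t0. destruct (ze t t0) as [I [HI ->]].
    f_equal. f_equal. symmetry. apply is_RInt_unique.
    eapply is_RInt_ext; [| exact HI]. intros s Hs. symmetry. now apply E.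
  - intros [zR ze]. split.
    + intros t t0 P HP. specialize (zR t P).
      cbv beta in zR. rewrite -> (Rmax_right 0 t t0) in zR.
      destruct (zR HP) as [d Hd]. exists d. intros u Hu u0. specialize (Hd u Hu).
      rewrite -> (Rmax_right 0 u u0) in Hd. exact Hd.
    + intros t t0. eexists. split; [| exact (ze t t0)].
      eapply is_RInt_ext; [intros s Hs; apply E; assumption |].
      apply (is_RInt_duhamel S hS hc).
      intros s. apply lipschitz_continuous, zR.
Qed.

(* With the weight [exp (k t)] the Picard map is a contraction of ratio 1/2. *)
Lemma picard_contraction (f g : R -> H) (m t : R) :
  0 <= t -> 0 <= m ->
  (forall s, continuous f s) -> (forall s, continuous g s) ->
  (forall s, 0 <= s <= t -> norm (minus (f s) (g s)) <= m * exp (k * s)) ->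
  norm (minus (scal lambda (duhamel S (fun s => B (f s)) t))
              (scal lambda (duhamel S (fun s => B (g s)) t))) <= m / 2 * exp (k * t).
Proof.
  intros t0 m0 fc gc fg.
  pose proof (duhamel_minus_le S hS hc (fun s => B (f s)) (fun s => B (g s))
    (fun s => L * m * exp (k * s)) t (L * m * (exp (k * t) - 1) / k) t0) as D.
  specialize (D (fun s => lipschitz_continuous f s (fc s))).
  specialize (D (fun s => lipschitz_continuous g s (gc s))).
  lapply D; clear D.
  2: { intros s Hs. eapply Rle_trans; [apply hB |].
       rewrite Rmult_assoc. apply Rmult_le_compat_l; [exact hL | now apply fg]. }
  intros D. specialize (D (is_RInt_exp _ _ _ (Rgt_not_eq _ _ hk))).
  set (X := duhamel S (fun s => B (f s)) t) in *.
  set (Y := duhamel S (fun s => B (g s)) t) in *.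
  replace (minus (scal lambda X) (scal lambda Y)) with (scal lambda (minus X Y))
    by vector_identity.
  eapply Rle_trans; [apply norm_scal_nonneg, hl |].
  eapply Rle_trans; [apply Rmult_le_compat_l; [exact hl | exact D] |].
  pose proof (exp_pos (k * t)) as ep.
  replace (lambda * (L * m * (exp (k * t) - 1) / k))
    with ((lambda * L / k) * (m * (exp (k * t) - 1))) by (field; lra).
  assert (r : 0 <= lambda * L / k <= / 2).
  { split.
    - apply Rdiv_le_0_compat; [nra | exact hk].
    - apply Rmult_le_reg_r with k; [exact hk |]. field_simplify; lra. }
  assert (e1 : 1 <= exp (k * t)).
  { pose proof (exp_ineq1_le (k * t)). nra. }
  assert (0 <= m * (exp (k * t) - 1)) by nra.
  assert (m * (exp (k * t) - 1) <= m * exp (k * t)) by nra. nra.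
Qed.

(** Starting from zero makes the distance between the limit and the initial iterate a growth bound
    for the solution. The clamped time makes every iterate continuous on the whole line. *)
Fixpoint picard (z0 : H) (n : nat) (t : R) : H :=
  match n with
  | O => zero
  | Datatypes.S p =>
      minus (S (Rmax 0 t) z0)
        (scal lambda (duhamel S (fun s => B (picard z0 p s)) (Rmax 0 t)))
  end.

Lemma picard_succ (z0 : H) (n : nat) (t : R) :
  0 <= t ->
  picard z0 (Datatypes.S n) t
  = minus (S t z0) (scal lambda (duhamel S (fun s => B (picard z0 n s)) t)).
Proof. intros t0. cbn [picard]. rewrite -> (Rmax_right 0 t t0). reflexivity. Qed.

Lemma picard_continuous (z0 : H) (n : nat) (t : R) : continuous (picard z0 n) t.
Proof.
  revert t. induction n as [| n IH]; intros t; simpl.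
  - apply continuous_const.
  - apply (continuous_minus (V := H)).
    + now apply orbit_continuous.
    + apply (continuous_scal_r (V := H) lambda), duhamel_continuous; try assumption.
      intros s. apply lipschitz_continuous, IH.
Qed.

(** Since B vanishes at zero, the first iterate is the orbit S(t) z0, of norm at most |z0|; each
    further Picard step halves the weighted bound. *)
Lemma picard_increment (z0 : H) (n : nat) (t : R) :
  0 <= t ->
  norm (minus (picard z0 (Datatypes.S n) t) (picard z0 n t))
    <= norm z0 * (/ 2) ^ n * exp (k * t).
Proof.
  revert t. induction n as [| n IH]; intros t t0.
  - assert (D0 : forall r, 0 <= r -> duhamel S (fun s => B (picard z0 0 s)) r = zero).
    { intros r r0. apply is_RInt_unique. rewrite -(scal_zero_r (V := H) (r - 0)).
      eapply is_RInt_ext; [| apply (is_RInt_const (V := H))].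
      intros s _. simpl. rewrite hB0. symmetry.
      apply (linear_zero (U := H) (V := H)), (semigroup_linear S hS), Rmax_l. }
    cbn [picard]. rewrite -> (Rmax_right 0 t t0). fold (picard z0 0).
    change (fun s => zero) with (picard z0 0).
    rewrite (D0 t t0) (norm_minus_zero_r (V := H)).
    have -> : minus (S t z0) (scal lambda zero) = S t z0 by vector_identity.
    eapply Rle_trans; [now apply hc |]. rewrite pow_O Rmult_1_r.
    assert (1 <= exp (k * t)) by (pose proof (exp_ineq1_le (k * t)); nra).
    pose proof (norm_ge_0 z0). nra.
  - rewrite (picard_succ z0 (Datatypes.S n) t t0).
    rewrite (picard_succ z0 n t t0).
    set (X := duhamel S (fun s => B (picard z0 (Datatypes.S n) s)) t).
    set (Y := duhamel S (fun s => B (picard z0 n s)) t).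
    have -> : minus (minus (S t z0) (scal lambda X)) (minus (S t z0) (scal lambda Y))
              = minus (scal lambda Y) (scal lambda X) by vector_identity.
    rewrite <- (tech_pow_Rmult (/ 2) n).
    replace (norm z0 * (/ 2 * (/ 2) ^ n)) with (norm z0 * (/ 2) ^ n / 2) by field.
    rewrite norm_minus_sym. unfold X, Y.
    apply picard_contraction; try apply picard_continuous; try assumption.
    + pose proof (pow_lt (/ 2) n ltac:(lra)). pose proof (norm_ge_0 z0). nra.
    + intros s Hs. apply IH. lra.
Qed.

Lemma picard_distance (z0 : H) (n j : nat) (t : R) :
  0 <= t ->
  norm (minus (picard z0 (n + j) t) (picard z0 n t))
    <= 2 * norm z0 * exp (k * t) * (/ 2) ^ n.
Proof.
  intros t0.
  (* The exact partial sum of the geometric series is what the induction on j reproduces; its upper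
     bound alone would not suffice. *)
  enough (E : norm (minus (picard z0 (n + j) t) (picard z0 n t))
            <= 2 * norm z0 * exp (k * t) * ((/ 2) ^ n - (/ 2) ^ (n + j))).
  { eapply Rle_trans; [exact E |].
    pose proof (pow_lt (/ 2) (n + j) ltac:(lra)).
    pose proof (Rmult_le_pos _ _ (norm_ge_0 z0) (Rlt_le _ _ (exp_pos (k * t)))). nra. }
  induction j as [| j IH].
  - rewrite Nat.add_0_r (minus_eq_zero (G := H)) norm_zero. lra.
  - rewrite Nat.add_succ_r.
    pose proof (picard_increment z0 (n + j) t t0) as D.
    pose proof (norm_minus_triangle (V := H) (picard z0 (n + j) t)
      (picard z0 (Datatypes.S (n + j)) t) (picard z0 n t)) as T.
    rewrite <- (tech_pow_Rmult (/ 2) (n + j)).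
    nra.
Qed.

(** The solution is the limit of the Picard iterates, and its growth bound is the error estimate at
    n = 0. *)
Lemma mild_solution_exists (z0 : H) :
  exists z : R -> H, mild_solution S B lambda z0 z /\
    forall t, 0 <= t -> norm (z t) <= 2 * norm z0 * exp (k * t).
Proof.
  (* Limits are taken at the clamped time, where the error estimate is available for every real
     t. *)
  set (lim t := geometric_cauchy_limit (fun n => picard z0 n (Rmax 0 t)) _
    (fun n j => picard_distance z0 n j (Rmax 0 t) (Rmax_l 0 t))).
  set (z t := proj1_sig (lim t)).
  assert (zm : forall n t, norm (minus (z t) (picard z0 n (Rmax 0 t)))
            <= 2 * norm z0 * exp (k * Rmax 0 t) * (/ 2) ^ n).
  { intros n t. exact (proj2_sig (lim t) n). }
  clearbody z. clear lim.
  assert (zn : forall n t, 0 <= t ->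
    norm (minus (z t) (picard z0 n t)) <= 2 * norm z0 * exp (k * t) * (/ 2) ^ n).
  { intros n t t0. specialize (zm n t). rewrite -> (Rmax_right 0 t t0) in zm.
    exact zm. }
  pose proof (norm_ge_0 z0) as N0.
  exists z. split.
  - apply mild_solution_iff.
    assert (zc : forall t, continuous (fun s => z (Rmax 0 s)) t).
    { intros t. apply (continuous_of_approximations (V := H)). intros eps.
      (* For |u - t| < 1 the weight is at most exp (k (Rmax 0 t + 1)), so a single index n serves a
         whole neighbourhood of t. *)
      destruct (half_pow_small (2 * norm z0 * exp (k * (Rmax 0 t + 1))) eps
        (cond_pos eps)) as [n Hn].
      exists (fun s => picard z0 n (Rmax 0 s)). split.
      - apply continuous_clamp. intros s. apply picard_continuous.
      - exists (mkposreal 1 Rlt_0_1). intros u Hu.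
        change (Rabs (u - t) < 1) in Hu.
        eapply Rle_trans; [apply zn, Rmax_l |].
        eapply Rle_trans; [| apply Rlt_le, Hn].
        pose proof (pow_lt (/ 2) n ltac:(lra)).
        apply Rmult_le_compat_r; [lra |]. apply Rmult_le_compat_l; [lra |].
        apply exp_le_compat, Rmult_le_compat_l; [lra |].
        pose proof (Rmax_nonexpansive 0 u t) as D.
        pose proof (Rle_abs (Rmax 0 u - Rmax 0 t)). lra. }
    split; [exact zc |]. intros t t0.
    set (X := duhamel _ _ _).
    enough (Z : norm (minus (z t) (minus (S t z0) (scal lambda X))) <= 0).
    { now apply eq_of_norm_minus_le_zero. }
    (* Both z(t) and the Picard image of z lie within |z0| exp (k t) (/ 2) ^ n of iterate n + 1, for
       every n. *)
    apply le_zero_of_half_pow with (2 * norm z0 * exp (k * t)). intros n.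
    pose proof (zn (Datatypes.S n) t t0) as Z1.
    pose proof (picard_contraction (picard z0 n) (fun s => z (Rmax 0 s))
      (2 * norm z0 * (/ 2) ^ n) t t0) as Z2.
    lapply Z2; clear Z2; [intros Z2 |].
    2: { pose proof (pow_lt (/ 2) n ltac:(lra)). nra. }
    specialize (Z2 (picard_continuous z0 n) zc).
    lapply Z2; clear Z2; [intros Z2 |].
    2: { intros s Hs. rewrite -> Rmax_right by lra. rewrite norm_minus_sym.
         eapply Rle_trans; [apply zn; lra |]. lra. }
    pose proof (norm_minus_triangle (picard z0 (Datatypes.S n) t) (z t)
      (minus (S t z0) (scal lambda X))) as T.
    eapply Rle_trans; [exact T |].
    rewrite -> (picard_succ z0 n t t0) in Z1 |- *.
    set (Y := duhamel S (fun s => B (picard z0 n s)) t) in *.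
    have -> : minus (minus (S t z0) (scal lambda Y)) (minus (S t z0) (scal lambda X))
              = minus (scal lambda X) (scal lambda Y) by vector_identity.
    rewrite norm_minus_sym in Z2. fold X in Z2.
    eapply Rle_trans; [apply Rplus_le_compat; [exact Z1 | exact Z2] |].
    rewrite <- tech_pow_Rmult. lra.
  - intros t t0. pose proof (zn 0%nat t t0) as P. simpl in P.
    rewrite (norm_minus_zero_r (V := H)) in P. lra.
Qed.

(** At a point a where exp (- k s) |w(s) - z(s)| attains its maximum m over [0, t], the contraction
    estimate gives m <= m / 2, hence m = 0. *)
Lemma mild_solution_unique (z0 : H) (w z : R -> H) (t : R) :
  mild_solution S B lambda z0 w -> mild_solution S B lambda z0 z ->
  0 <= t -> w t = z t.
Proof.
  intros mw mz t0.
  apply mild_solution_iff in mw as [wc we]. apply mild_solution_iff in mz as [zc ze].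
  set (d s := norm (minus (w (Rmax 0 s)) (z (Rmax 0 s)))).
  destruct (continuous_bounded_above (fun s => exp (- (k * s)) * d s) 0 t t0)
    as [a [[a0 at_] Ha]].
  { intros s. apply (continuous_mult (K := R_AbsRing)).
    - apply (ex_derive_continuous (V := R_NormedModule)). auto_derive. exact I.
    - apply continuous_norm, (continuous_minus (V := H)); [apply wc | apply zc]. }
  assert (E : forall s, exp (- (k * s)) * exp (k * s) = 1).
  { intros s. rewrite -exp_plus. replace (- (k * s) + k * s) with 0 by ring.
    apply exp_0. }
  set (m := exp (- (k * a)) * d a) in *.
  assert (m0 : 0 <= m).
  { apply Rmult_le_pos; [apply Rlt_le, exp_pos | apply norm_ge_0]. }
  assert (dm : forall s, 0 <= s <= t -> d s <= m * exp (k * s)).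
  { intros s Hs. specialize (Ha s Hs). cbv beta in Ha.
    replace (d s) with (exp (- (k * s)) * d s * exp (k * s)).
    - apply Rmult_le_compat_r; [apply Rlt_le, exp_pos | exact Ha].
    - rewrite <- (Rmult_1_l (d s)) at 2. rewrite <- (E s). ring. }
  pose proof (picard_contraction (fun s => w (Rmax 0 s)) (fun s => z (Rmax 0 s))
    m a a0 m0 wc zc) as C.
  lapply C; clear C; [intros C | intros s Hs; apply dm; lra].
  assert (da : d a <= m / 2 * exp (k * a)).
  { unfold d. rewrite -> (Rmax_right 0 a a0).
    rewrite (we a a0) (ze a a0). rewrite norm_minus_sym.
    set (X := scal lambda (duhamel S (fun s => B (w (Rmax 0 s))) a)) in *.
    set (Y := scal lambda (duhamel S (fun s => B (z (Rmax 0 s))) a)) in *.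
    eapply Rle_trans; [| exact C]. right. f_equal. vector_identity. }
  assert (m = 0).
  { pose proof (exp_pos (- (k * a))). specialize (E a).
    assert (m <= exp (- (k * a)) * (m / 2 * exp (k * a)))
      by (apply Rmult_le_compat_l; lra).
    nra. }
  specialize (dm t ltac:(lra)). unfold d in dm. rewrite -> (Rmax_right 0 t t0) in dm.
  apply eq_of_norm_minus_le_zero. nra.
Qed.

(** The system is autonomous: the semigroup law and the splitting of the Duhamel integral at s turn
    the tail of a solution into a solution. This is what allows a one-period estimate to be
    iterated. *)
Lemma mild_solution_shift (z0 : H) (z : R -> H) (s : R) :
  0 <= s -> mild_solution S B lambda z0 z ->
  mild_solution S B lambda (z s) (fun t => z (s + t)).
Proof.
  intros s0 mz. apply mild_solution_iff in mz as [zc ze]. apply mild_solution_iff.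
  assert (zR : forall r, 0 <= r -> z r = z (Rmax 0 r)).
  { intros r r0. now rewrite -> Rmax_right. }
  split.
  - intros t.
    apply (continuous_ext (fun r => z (Rmax 0 (s + Rmax 0 r)))).
    + intros r. symmetry. apply zR. pose proof (Rmax_l 0 r). lra.
    + apply (continuous_comp (fun r => s + Rmax 0 r) (fun r => z (Rmax 0 r)));
        [| apply zc].
      apply (continuous_plus (V := R_NormedModule) (fun _ => s) (Rmax 0));
        [apply continuous_const | apply continuous_Rmax_l].
  - intros t t0. rewrite -> (ze (s + t)) by lra.
    rewrite -> (duhamel_shift S hS hc (fun r => B (z (Rmax 0 r))) s t s0 t0)
      by (intros r; apply lipschitz_continuous, zc).
    replace (s + t) with (t + s) by ring. rewrite -> (semigroup_plus S hS) by assumption.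
    rewrite -> (duhamel_ext S (fun r => B (z (Rmax 0 (s + r))))
      (fun r => B (z (s + Rmax 0 r))) t t0)
      by (intros r Hr; rewrite -> !Rmax_right by lra; reflexivity).
    rewrite -> (ze s s0), (semigroup_minus S hS) by exact t0.
    rewrite (linear_scal (U := H) (V := H) (S t) (semigroup_linear S hS t t0)).
    vector_identity.
Qed.

End MildSolutions.

(** * Continuity of the inner product and the defect form of a contraction *)

Lemma inner_polarization {H : HilbertSpace} (x y : H) :
  inner x y = / 4 * (norm (plus x y) ^ 2 - norm (minus x y) ^ 2).
Proof.
  rewrite -!inner_norm inner_minus_l (inner_plus_l H x y).
  rewrite !(inner_sym H _ (minus x y)) !(inner_sym H _ (plus x y)).
  rewrite !inner_minus_l !inner_plus_l (inner_sym H y x). field.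
Qed.

(** By polarization, the continuity of the norm suffices. *)
Lemma continuous_inner {H : HilbertSpace} (f g : R -> H) (t : R) :
  continuous f t -> continuous g t -> continuous (fun s => inner (f s) (g s)) t.
Proof.
  intros fc gc.
  eapply continuous_ext; [intros s; symmetry; apply inner_polarization |].
  assert (sq : forall h : R -> H, continuous h t -> continuous (fun s => norm (h s) ^ 2) t).
  { intros h hh. apply (continuous_comp (fun s => norm (h s)) (fun x => x ^ 2)).
    - apply continuous_norm, hh.
    - apply (ex_derive_continuous (V := R_NormedModule)). auto_derive. exact I. }
  apply (continuous_scal_r (V := R_NormedModule) (/ 4)).
  apply (continuous_minus (V := R_NormedModule)).
  - apply sq, (continuous_plus (V := H)); assumption.
  - apply sq, (continuous_minus (V := H)); assumption.
Qed.

(* Positivity of the form [<x,y> - <C x, C y>] at [y - mu b]; this is what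
   replaces the energy inequality of mild solutions. *)
Lemma contraction_defect {H : HilbertSpace} (C : H -> H) (b y : H) (mu : R) :
  is_linear C -> (forall x, norm (C x) <= norm x) ->
  2 * mu * (inner b y - inner (C b) (C y))
    <= norm y ^ 2 - norm (C y) ^ 2 + mu ^ 2 * norm b ^ 2.
Proof.
  intros Cl Cc. set (e := minus y (scal mu b)).
  assert (Ce : C e = minus (C y) (scal mu (C b))).
  { unfold e. rewrite (linear_minus (U := H) (V := H) C _ _ Cl).
    rewrite (linear_scal (U := H) (V := H) C Cl). reflexivity. }
  assert (E : inner (C e) (C e) <= inner e e).
  { rewrite !inner_norm. apply pow_incr. split; [apply norm_ge_0 | apply Cc]. }
  assert (sq : forall u v : H, inner (minus u (scal mu v)) (minus u (scal mu v))
            = norm u ^ 2 - 2 * mu * inner v u + mu ^ 2 * norm v ^ 2).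
  { intros u v. rewrite inner_minus_l inner_scal_l.
    rewrite !(inner_sym H _ (minus u (scal mu v))) !inner_minus_l !inner_scal_l.
    rewrite !inner_norm (inner_sym H u v). ring. }
  rewrite Ce in E. unfold e in E. rewrite !sq in E.
  pose proof (Rmult_le_pos _ _ (pow2_ge_0 mu) (pow2_ge_0 (norm (C b)))). lra.
Qed.

Lemma duhamel_norm_le {H : HilbertSpace} (S : R -> H -> H) (f : R -> H) (t M : R) :
  is_C0_semigroup S -> is_contractive S -> 0 <= t ->
  (forall s, continuous f s) -> (forall s, 0 <= s <= t -> norm (f s) <= M) ->
  norm (duhamel S f t) <= t * M.
Proof.
  intros hS hc t0 fc fM. replace (t * M) with ((t - 0) * M) by ring.
  eapply norm_RInt_le_const; [exact t0 | | apply (is_RInt_duhamel S hS hc f t fc)].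
  intros s Hs. eapply Rle_trans; [apply hc, Rmax_l | now apply fM].
Qed.

(** * Exponential decay *)

Section Decay.

Context {H : HilbertSpace} (S : R -> H -> H).
Hypothesis hS : is_C0_semigroup S.
Hypothesis hc : is_contractive S.
Context (B : H -> H) (L lambda T delta : R).
Hypothesis hL : 0 <= L.
Hypothesis hB : forall x y, norm (minus (B x) (B y)) <= L * norm (minus x y).
Hypothesis hB0 : B zero = zero.
Hypothesis hl : 0 <= lambda.
Hypothesis hT : 0 < T.

Lemma lipschitz_growth (x : H) : norm (B x) <= L * norm x.
Proof.
  pose proof (hB x zero) as E. rewrite hB0 !(norm_minus_zero_r (V := H)) in E. exact E.
Qed.

(** The factor (1 + K)^2 collects three errors, in units of (lambda T L |z0|)^2: 1 from completing
    the square, 2 K from replacing z by the free orbit inside B, and K^2 from the squared norm of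
    the Duhamel integral. *)
Lemma mild_solution_period_decrease (z0 : H) (z : R -> H) (K : R) :
  mild_solution S B lambda z0 z ->
  (forall s, 0 <= s <= T -> norm (z s) <= K * norm z0) ->
  delta * norm z0 ^ 2 <= RInt (fun t => inner (B (S t z0)) (S t z0)) 0 T ->
  norm (z T) ^ 2
    <= (1 - 2 * lambda * delta + lambda ^ 2 * (T * L * (1 + K)) ^ 2) * norm z0 ^ 2.
Proof.
  intros mz zK obs.
  apply (mild_solution_iff S hS hc B L lambda hL hB) in mz as [zc ze].
  set (N := norm z0) in *. pose proof (norm_ge_0 z0) as N0. fold N in N0.
  assert (KN : 0 <= K * N).
  { eapply Rle_trans; [apply (norm_ge_0 (z T)) | apply (zK T); lra]. }
  set (f s := B (z (Rmax 0 s))) in *.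
  assert (fc : forall s, continuous f s).
  { intros s. apply (lipschitz_continuous B L hL hB), zc. }
  assert (fK : forall s, 0 <= s <= T -> norm (f s) <= L * (K * N)).
  { intros s Hs. unfold f. rewrite -> Rmax_right by lra.
    eapply Rle_trans; [apply lipschitz_growth |].
    apply Rmult_le_compat_l; [exact hL | now apply zK]. }
  (* The solution stays within O(lambda) of the free orbit, so exchanging them in the cross term
     costs only O(lambda^2). *)
  assert (zS : forall s, 0 <= s <= T ->
            norm (minus (z s) (S s z0)) <= lambda * (T * (L * (K * N)))).
  { intros s Hs. rewrite -> (ze s) by lra.
    have -> : minus (minus (S s z0) (scal lambda (duhamel S f s))) (S s z0)
              = opp (scal lambda (duhamel S f s)) by vector_identity.
    rewrite (norm_opp (V := H)).
    eapply Rle_trans; [apply norm_scal_nonneg, hl |].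
    apply Rmult_le_compat_l; [exact hl |].
    eapply Rle_trans; [apply (duhamel_norm_le S f s (L * (K * N))); try assumption |].
    - lra.
    - intros r Hr. apply fK. lra.
    - apply Rmult_le_compat_r; [now apply Rmult_le_pos | lra]. }
  set (y := S T z0).
  set (g s := inner (B (S (Rmax 0 s) z0)) (S (Rmax 0 s) z0)).
  (* A bound independent of s: the contraction defect over the whole window, the error of completing
     the square, and the error of exchanging z(s) with the orbit. *)
  set (c := N ^ 2 - norm y ^ 2 + (lambda * T) ^ 2 * (L * N) ^ 2
            + 2 * lambda * T * (L * (lambda * (T * (L * (K * N)))) * N)).
  assert (yN : norm y <= N) by (apply hc; lra).
  assert (pointwise : forall s, 0 < s < T ->
    2 * lambda * T * g s - c
      <= 2 * lambda * T * inner (S (Rmax 0 (T - s)) (f s)) y).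
  { intros s Hs. unfold f, g. rewrite -> !Rmax_right by lra.
    set (x := S s z0).
    assert (xN : norm x <= N) by (apply hc; lra).
    assert (yx : y = S (T - s) x).
    { unfold x. rewrite <- (semigroup_plus S hS) by lra. unfold y. f_equal. ring. }
    (* With mu = lambda T, integrating over [0, T] and dividing by T leaves the defect N^2 - |y|^2
       with coefficient 1, so that it cancels the |y|^2 in the expansion of |z(T)|^2. *)
    pose proof (contraction_defect (S (T - s)) (B x) x (lambda * T)
      (semigroup_linear S hS (T - s) ltac:(lra))
      (fun u => hc (T - s) u ltac:(lra))) as D.
    rewrite -yx in D.
    assert (x2 : norm x ^ 2 <= N ^ 2).
    { apply pow_incr. split; [apply norm_ge_0 | exact xN]. }
    assert (b2 : norm (B x) ^ 2 <= (L * N) ^ 2).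
    { apply pow_incr. split; [apply norm_ge_0 |].
      eapply Rle_trans; [apply lipschitz_growth |].
      now apply Rmult_le_compat_l. }
    pose proof (Rmult_le_compat_l _ _ _ (pow2_ge_0 (lambda * T)) b2) as b3.
    assert (P : inner (S (T - s) (B x)) y - inner (S (T - s) (B (z s))) y
              <= L * (lambda * (T * (L * (K * N)))) * N).
    { rewrite -inner_minus_l -(semigroup_minus S hS); [| lra].
      eapply Rle_trans; [apply Rle_abs |].
      eapply Rle_trans; [apply cauchy_schwarz |].
      apply Rmult_le_compat; [apply norm_ge_0 | apply norm_ge_0 | | exact yN].
      eapply Rle_trans; [apply hc; lra |].
      eapply Rle_trans; [apply hB |].
      apply Rmult_le_compat_l; [exact hL |].
      rewrite norm_minus_sym. apply zS. lra. }
    assert (lT : 0 <= 2 * lambda * T) by nra.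
    pose proof (Rmult_le_compat_l _ _ _ lT P) as P2.
    unfold c. lra. }
  assert (gc : forall s, continuous g s).
  { intros s. apply continuous_inner; [apply (lipschitz_continuous B L hL hB) |];
      now apply orbit_continuous. }
  assert (G : delta * N ^ 2 <= RInt g 0 T).
  { eapply Rle_trans; [exact obs |]. right. apply (RInt_ext (V := R_CompleteNormedModule)).
    intros s. rewrite -> Rmin_left, Rmax_right by lra. intros Hs. unfold g.
    rewrite -> Rmax_right by lra. reflexivity. }
  set (I := duhamel S f T).
  assert (J : 2 * lambda * T * RInt g 0 T - T * c <= 2 * lambda * T * inner I y).
  { apply (is_RInt_le (fun s => 2 * lambda * T * g s - c)
      (fun s => 2 * lambda * T * inner (S (Rmax 0 (T - s)) (f s)) y) 0 T);
      [lra | | | exact pointwise].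
    - apply (is_RInt_minus (V := R_NormedModule)).
      + apply (is_RInt_scal (V := R_NormedModule) g).
        apply (RInt_correct (V := R_CompleteNormedModule)).
        now apply (ex_RInt_cont (V := R_CompleteNormedModule)).
      + replace (T * c) with (scal (T - 0) c)
          by (unfold scal; simpl; unfold mult; simpl; ring).
        apply (is_RInt_const (V := R_NormedModule)).
    - apply (is_RInt_scal (V := R_NormedModule)
        (fun s => inner (S (Rmax 0 (T - s)) (f s)) y)).
      apply (is_RInt_linear (U := H) (V := R_NormedModule) (fun x => inner x y));
        [apply inner_is_linear | now apply is_RInt_duhamel]. }
  assert (J' : 2 * lambda * RInt g 0 T - c <= 2 * lambda * inner I y).
  { apply Rmult_le_reg_l with T; [exact hT |]. lra. }
  assert (IN : norm I ^ 2 <= (T * (L * (K * N))) ^ 2).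
  { apply pow_incr. split; [apply norm_ge_0 |].
    apply duhamel_norm_le; try assumption. lra. }
  assert (Z : norm (z T) ^ 2 = norm y ^ 2 - 2 * lambda * inner I y + lambda ^ 2 * norm I ^ 2).
  { rewrite -> (ze T) by lra. fold y I. rewrite -!inner_norm.
    rewrite inner_minus_l inner_scal_l.
    rewrite !(inner_sym H _ (minus y (scal lambda I))) !inner_minus_l !inner_scal_l.
    rewrite (inner_sym H y I). ring. }
  rewrite Z.
  pose proof (Rmult_le_compat_l _ _ _ (pow2_ge_0 lambda) IN).
  assert (l2 : 0 <= 2 * lambda) by lra.
  pose proof (Rmult_le_compat_l _ _ _ l2 G).
  unfold c in J'. lra.
Qed.

End Decay.

(** * Iteration over periods and the decay rate *)

(** Uniqueness transfers the bound from the constructed solution to any mild solution, in particular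
    to shifted ones. *)
Lemma mild_solution_growth {H : HilbertSpace} (S : R -> H -> H) (B : H -> H)
    (L lambda k : R) (z0 : H) (z : R -> H) (t : R) :
  is_C0_semigroup S -> is_contractive S -> 0 <= L ->
  (forall x y, norm (minus (B x) (B y)) <= L * norm (minus x y)) -> B zero = zero ->
  0 <= lambda -> 0 < k -> 2 * lambda * L <= k ->
  mild_solution S B lambda z0 z -> 0 <= t ->
  norm (z t) <= 2 * norm z0 * exp (k * t).
Proof.
  intros hS hc hL hB hB0 hl hk hlk mz t0.
  destruct (mild_solution_exists S hS hc B L lambda k hL hB hB0 hl hk hlk z0)
    as [w [mw wN]].
  rewrite (mild_solution_unique S hS hc B L lambda k hL hB hl hk hlk z0 z w t mz mw t0).
  now apply wN.
Qed.

(** Each period restarts from the state z(n T); this is why the one-period estimate is assumed for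
    every initial state. *)
Lemma mild_solution_periods {H : HilbertSpace} (S : R -> H -> H) (B : H -> H)
    (L lambda T q : R) (z0 : H) (z : R -> H) (n : nat) :
  is_C0_semigroup S -> is_contractive S -> 0 <= L ->
  (forall x y, norm (minus (B x) (B y)) <= L * norm (minus x y)) ->
  0 <= T -> 0 <= q ->
  (forall w0 w, mild_solution S B lambda w0 w -> norm (w T) <= q * norm w0) ->
  mild_solution S B lambda z0 z ->
  norm (z (INR n * T)) <= q ^ n * norm z0.
Proof.
  intros hS hc hL hB hT hq step mz. induction n as [| n IH].
  - apply (mild_solution_iff S hS hc B L lambda hL hB) in mz as [_ ze].
    simpl. rewrite Rmult_0_l Rmult_1_l. rewrite -> (ze 0) by lra.
    unfold duhamel. rewrite (RInt_point (V := H)) (semigroup_zero S hS).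
    have -> : minus z0 (scal lambda zero) = z0 by vector_identity. apply Rle_refl.
  - assert (nT : 0 <= INR n * T) by (apply Rmult_le_pos; [apply pos_INR | exact hT]).
    pose proof (step _ _ (mild_solution_shift S hS hc B L lambda hL hB z0 z _ nT mz)) as E.
    rewrite S_INR. replace ((INR n + 1) * T) with (INR n * T + T) by ring.
    eapply Rle_trans; [exact E |]. rewrite <- tech_pow_Rmult, Rmult_assoc.
    now apply Rmult_le_compat_l.
Qed.

Lemma exp_pow_INR (x : R) (n : nat) : exp x ^ n = exp (INR n * x).
Proof.
  induction n as [| n IH].
  - rewrite Rmult_0_l exp_0. reflexivity.
  - rewrite S_INR -tech_pow_Rmult IH -exp_plus. f_equal. ring.
Qed.

Theorem theorem6 (H : HilbertSpace)
    (domA : H -> Prop) (A : {x : H | domA x} -> H) (S0 : R -> H -> H)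
    (hS0 : is_C0_semigroup S0) (hcontr : is_contractive S0)
    (hgen : generates domA A S0)
    (B : H -> H) (hLip : is_lipschitz B) (hB0 : B zero = zero)
    (delta T : R) (hdelta : 0 < delta) (hT : 0 < T)
    (hobs : forall y : H,
      RInt (fun t => inner (B (S0 t y)) (S0 t y)) 0 T >= delta * norm y ^ 2) :
  exists lambda_max : R, 0 < lambda_max /\
    forall lambda : R, 0 < lambda < lambda_max ->
      uniformly_exponentially_stabilized S0 B lambda.
Proof.
  (* The given constant may be zero or negative; a positive one is needed for the divisions
     below. *)
  destruct hLip as [L0 hL0]. set (L := Rabs L0 + 1).
  assert (L1 : 0 < L) by (pose proof (Rabs_pos L0); unfold L; lra).
  assert (hB : forall x y, norm (minus (B x) (B y)) <= L * norm (minus x y)).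
  { intros x y. eapply Rle_trans; [apply hL0 |].
    apply Rmult_le_compat_r; [apply norm_ge_0 |].
    pose proof (Rle_abs L0). unfold L; lra. }
  (* The growth bound 2 exp (k t) with k = 1/T is at most 2 e over one period. *)
  set (K := 2 * exp 1). assert (K0 : 0 < K) by (pose proof (exp_pos 1); unfold K; lra).
  set (Q := T * L * (1 + K)).
  assert (Q0 : 0 < Q) by (unfold Q; repeat apply Rmult_lt_0_compat; lra).
  assert (Q2 : 0 < Q ^ 2) by now apply pow_lt.
  assert (TL : 0 < 2 * (T * L)) by nra.
  (* The first bound gives 2 lambda L <= 1/T, as the Picard contraction with k = 1/T requires. The
     second gives lambda^2 Q^2 <= lambda delta, so half of the gain 2 lambda delta survives the
     quadratic error. *)
  exists (Rmin (/ (2 * (T * L))) (delta / Q ^ 2)). split.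
  { apply Rmin_glb_lt; [now apply Rinv_0_lt_compat | now apply Rdiv_lt_0_compat]. }
  intros lambda [l0 lmax]. apply Rmin_Rgt_l in lmax as [lmax1 lmax2].
  assert (lL : 2 * lambda * L <= / T).
  { apply Rmult_le_reg_r with T; [exact hT |]. rewrite -> Rinv_l by lra.
    apply Rmult_lt_compat_r with (r := 2 * (T * L)) in lmax1; [| exact TL].
    rewrite -> Rinv_l in lmax1 by lra. lra. }
  assert (lQ : lambda * Q ^ 2 <= delta).
  { apply Rmult_lt_compat_r with (r := Q ^ 2) in lmax2; [| exact Q2].
    unfold Rdiv in lmax2. rewrite -> Rmult_assoc, Rinv_l, Rmult_1_r in lmax2 by lra. lra. }
  assert (k0 : 0 < / T) by now apply Rinv_0_lt_compat.
  assert (grow : forall w0 w t, mild_solution S0 B lambda w0 w -> 0 <= t <= T ->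
            norm (w t) <= K * norm w0).
  { intros w0 w t mw Ht.
    eapply Rle_trans; [eapply (mild_solution_growth S0 B L lambda (/ T));
      try eassumption; lra |].
    assert (exp (/ T * t) <= exp 1).
    { apply exp_le_compat. rewrite <- (Rinv_l T) by lra.
      apply Rmult_le_compat_l; lra. }
    unfold K. pose proof (norm_ge_0 w0). nra. }
  (* Chosen so that q^2 = exp (- lambda delta) >= 1 - lambda delta, which dominates the one-period
     factor. *)
  set (q := exp (- (lambda * delta / 2))).
  assert (step : forall w0 w, mild_solution S0 B lambda w0 w -> norm (w T) <= q * norm w0).
  { intros w0 w mw.
    pose proof (mild_solution_period_decrease S0 hS0 hcontr B L lambda T delta
      (Rlt_le _ _ L1) hB hB0 (Rlt_le _ _ l0) hT w0 w K mw
      (fun s => grow w0 w s mw) (Rge_le _ _ (hobs w0))) as D.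
    fold Q in D.
    assert (q2 : 1 - lambda * delta <= q ^ 2).
    { unfold q. simpl. rewrite Rmult_1_r -exp_plus.
      replace (- (lambda * delta / 2) + - (lambda * delta / 2))
        with (- (lambda * delta)) by field.
      pose proof (exp_ineq1_le (- (lambda * delta))). lra. }
    apply Rsqr_incr_0_var.
    - unfold Rsqr.
      assert (1 - 2 * lambda * delta + lambda ^ 2 * Q ^ 2 <= q ^ 2) by nra.
      pose proof (pow2_ge_0 (norm w0)). nra.
    - apply Rmult_le_pos; [apply Rlt_le, exp_pos | apply norm_ge_0]. }
  (* This is the rate for which q = exp (- sigma T). *)
  set (sigma := lambda * delta / (2 * T)).
  (* K covers the growth within the last, incomplete period, and exp (sigma T) the decay not yet
     earned in it. *)
  exists (K * exp (sigma * T)), sigma.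
  split; [apply Rmult_lt_0_compat; [exact K0 | apply exp_pos] |].
  assert (s0 : 0 < sigma) by (unfold sigma; apply Rdiv_lt_0_compat; nra).
  split; [exact s0 |]. intros z0.
  destruct (mild_solution_exists S0 hS0 hcontr B L lambda (/ T) (Rlt_le _ _ L1) hB hB0
    (Rlt_le _ _ l0) k0 lL z0) as [z [mz _]].
  exists z. split; [exact mz |]. split.
  { intros w mw t t0.
    now apply (mild_solution_unique S0 hS0 hcontr B L lambda (/ T) (Rlt_le _ _ L1) hB
      (Rlt_le _ _ l0) k0 lL z0). }
  intros t t0.
  (* Time is written as t = n T + r with 0 <= r < T: decay over n full periods, then bounded growth
     over r. *)
  destruct (nfloor_ex (t / T)) as [n [Hn1 Hn2]].
  { apply Rdiv_le_0_compat; [exact t0 | exact hT]. }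
  apply Rle_div_r in Hn1; [| exact hT]. apply Rlt_div_l in Hn2; [| exact hT].
  assert (nT : 0 <= INR n * T) by (apply Rmult_le_pos; [apply pos_INR | lra]).
  pose proof (mild_solution_shift S0 hS0 hcontr B L lambda (Rlt_le _ _ L1) hB z0 z _ nT mz)
    as ms.
  pose proof (grow _ _ (t - INR n * T) ms ltac:(lra)) as E1. cbv beta in E1.
  replace (INR n * T + (t - INR n * T)) with t in E1 by ring.
  assert (E2 : norm (z (INR n * T)) <= q ^ n * norm z0).
  { apply (mild_solution_periods S0 B L lambda T q z0 z n); try assumption; try lra.
    apply Rlt_le, exp_pos. }
  (* Since n T > t - T, at most one period of decay is lost. *)
  assert (E3 : q ^ n <= exp (sigma * T) * exp (- sigma * t)).
  { unfold q. rewrite -> exp_pow_INR, <- exp_plus. apply exp_le_compat.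
    replace (lambda * delta / 2) with (sigma * T) by (unfold sigma; field; lra).
    nra. }
  clearbody K sigma q. eapply Rle_trans; [exact E1 |]. rewrite !Rmult_assoc.
  apply Rmult_le_compat_l; [lra |]. eapply Rle_trans; [exact E2 |].
  rewrite -Rmult_assoc. apply Rmult_le_compat_r; [apply norm_ge_0 | exact E3].
Qed.
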